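(* Let $\mathcal E=(E_1,E_2,E_?)$ be an optimal USD measurement of a pair of weighted density operators $\mathcal S=(\gamma_1,\gamma_2)$ on a finite-dimensional complex Hilbert space $\mathscr H$, with $\operatorname{supp}\gamma_1\cap\operatorname{supp}\gamma_2=\{0\}$. Then $\operatorname{tr}(E_1\gamma_1)=0$ if and only if $\gamma_1(\gamma_2-\gamma_1)\gamma_1\ge 0$. In this case the success probability is $P_{\mathrm{succ}}(\mathcal E;\mathcal S)=\operatorname{tr}(\Lambda_2\gamma_2)$, and if $\mathcal E$ is proper, then $\mathcal E=(0,\Lambda_2,1-\Lambda_2)$, where $\Lambda_2$ is the orthogonal projector onto $\ker\gamma_1\cap\operatorname{supp}\mathcal S$.
   Context: A weighted density operator is a positive semi-definite operator on $\mathscr H$ (no normalization of the trace is required). For a positive semi-definite operator $\rho$, $\operatorname{supp}\rho=(\ker\rho)^\perp$. For $\mathcal S=(\gamma_1,\gamma_2)$ put $\operatorname{supp}\mathcal S=\operatorname{supp}(\gamma_1+\gamma_2)=\operatorname{supp}\gamma_1+\operatorname{supp}\gamma_2$. A USD (unambiguous state discrimination) measurement of $\mathcal S$ is a triple $\mathcal E=(E_1,E_2,E_?)$ of positive semi-definite operators on $\mathscr H$ with $E_1+E_2+E_?=1$ (identity), $\operatorname{tr}(E_2\gamma_1)=0$ and $\operatorname{tr}(E_1\gamma_2)=0$. Its success probability is $P_{\mathrm{succ}}(\mathcal E;\mathcal S)=\operatorname{tr}(E_1\gamma_1)+\operatorname{tr}(E_2\gamma_2)$. It is optimal if its success probability is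 maximal among all USD measurements of $\mathcal S$, and proper if $\operatorname{supp}(E_1+E_2)\subseteq\operatorname{supp}\mathcal S$. *)

(* Defs.v *)
From mathcomp Require Import all_boot all_order all_algebra.

Set Implicit Arguments.
Unset Strict Implicit.
Unset Printing Implicit Defensive.

Import Order.TTheory GRing.Theory Num.Theory.
Local Open Scope ring_scope.

(* The Hilbert space is C^n with its standard inner product [dotmx].  Vectors
   are rows and an operator A is v |-> v *m A, so that [kermx A] is the kernel
   of A and subspaces are row spaces (scope %MS). *)
Section USD.
Variables (C : numClosedFieldType) (n : nat).
Implicit Types A : 'M[C]_n.

Definition psdmx A : Prop :=
  A \is hermsymmx /\ forall v : 'rV[C]_n, 0 <= dotmx (v *m A) v.

Definition orthocompl m (U : 'M[C]_(m, n)) : 'M[C]_n :=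
  orthomx (@Num.conj C) (mx_of_hermitian (hermitian1mx n)) U.

Definition supp A : 'M[C]_n := orthocompl (kermx A).

Definition supp_pair (g1 g2 : 'M[C]_n) : 'M[C]_n := supp (g1 + g2).

Definition usd_measurement (g1 g2 E1 E2 Einc : 'M[C]_n) : Prop :=
  [/\ [/\ psdmx E1, psdmx E2 & psdmx Einc],
      E1 + E2 + Einc = 1%:M,
      \tr (E2 *m g1) = 0 &
      \tr (E1 *m g2) = 0].

(* Traces of products of psd operators are real, and on real elements the
   partial order of C is the usual order. *)
Definition psucc (g1 g2 E1 E2 : 'M[C]_n) : C := \tr (E1 *m g1) + \tr (E2 *m g2).

Definition optimal_usd (g1 g2 E1 E2 Einc : 'M[C]_n) : Prop :=
  usd_measurement g1 g2 E1 E2 Einc /\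
  forall F1 F2 Finc : 'M[C]_n, usd_measurement g1 g2 F1 F2 Finc ->
    psucc g1 g2 F1 F2 <= psucc g1 g2 E1 E2.

Definition proper_usd (g1 g2 E1 E2 : 'M[C]_n) : Prop :=
  (supp (E1 + E2) <= supp_pair g1 g2)%MS.

Definition Lambda2 (g1 g2 : 'M[C]_n) : 'M[C]_n :=
  proj_ortho (kermx g1 :&: supp_pair g1 g2)%MS.

End USD.

(* Main.v *)
Require Import Defs.
From mathcomp Require Import all_boot all_order all_algebra.
From mathcomp Require Import reals complex.

(* Let Q be the orthogonal projector onto ker g1; since ker g1 and supp S give
   commuting projectors, tr (Lambda2 g2) = tr (Q g2), which is the success
   probability of (0, Q, 1 - Q).
   If g1 (g2 - g1) g1 >= 0, then Z = Q g2 Q is dual feasible, because E1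
   annihilates g2 and hence tr (E1 Z) = tr (E1 (1 - Q) g2 (1 - Q)); optimality
   then forces Einc Z = 0, so that E1 vanishes on Q g2 and tr (E1 g1) = 0.
   Conversely, disjointness of the supports lets one write each x in supp g1 as
   w - y with w in ker g2 and y in ker g1.  Mixing the rank-one operator of w
   into E1 at the expense of that of y in Q gains <x, g1 x> and loses
   <x, g2 x> to first order, so (0, Q, 1 - Q) can only be optimal if
   <x, g1 x> <= <x, g2 x>. *)

Set Implicit Arguments.
Unset Strict Implicit.
Unset Printing Implicit Defensive.

Import Order.TTheory GRing.Theory Num.Theory.
Local Open Scope ring_scope.

(** * Conjugate transposes and Gram matrices *)

Definition adjmx (C : numClosedFieldType) m n (A : 'M[C]_(m, n)) : 'M[C]_(n, m) :=
  (map_mx (@Num.conj C) (A^T)).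

Local Notation "A ^H" := (adjmx A) (at level 8, format "A ^H") : ring_scope.

Section Adjoint.
Variable C : numClosedFieldType.

Lemma adjmxM m n p (A : 'M[C]_(m, n)) (B : 'M[C]_(n, p)) :
  (A *m B)^H = B^H *m A^H.
Proof. by rewrite /adjmx trmx_mul map_mxM. Qed.

Lemma adjmxK m n (A : 'M[C]_(m, n)) : A^H^H = A.
Proof. exact: trmxCK. Qed.

Lemma adjmxD m n (A B : 'M[C]_(m, n)) : (A + B)^H = A^H + B^H.
Proof. by rewrite /adjmx linearD /= map_mxD. Qed.

Lemma adjmxB m n (A B : 'M[C]_(m, n)) : (A - B)^H = A^H - B^H.
Proof. by rewrite /adjmx linearB /= map_mxB. Qed.

Lemma adjmxZ m n a (A : 'M[C]_(m, n)) : (a *: A)^H = a^* *: A^H.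
Proof. by rewrite /adjmx linearZ /= map_mxZ. Qed.

Lemma adjmx0 m n : (0 : 'M[C]_(m, n))^H = 0.
Proof. by rewrite /adjmx trmx0 map_mx0. Qed.

Lemma adjmx1 n : (1%:M : 'M[C]_n)^H = 1%:M.
Proof. by rewrite /adjmx trmx1 map_mx1. Qed.

Lemma hermsymmxE n (A : 'M[C]_n) : (A \is hermsymmx) <-> A^H = A.
Proof.
split=> [/is_hermitianmxP|] eA; first by rewrite /adjmx {2}eA expr0 scale1r.
by apply/is_hermitianmxP; rewrite expr0 scale1r.
Qed.

Lemma gram_diag_ge0 m n (X : 'M[C]_(m, n)) i : 0 <= (X *m X^H) i i.
Proof. by rewrite mxE sumr_ge0 // => k _; rewrite !mxE mul_conjC_ge0. Qed.

Lemma gram_trace_ge0 m n (X : 'M[C]_(m, n)) : 0 <= \tr (X *m X^H).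
Proof. by apply: sumr_ge0 => i _; exact: gram_diag_ge0. Qed.

Lemma gram_trace_eq0 m n (X : 'M[C]_(m, n)) : \tr (X *m X^H) = 0 -> X = 0.
Proof.
move=> /eqP; rewrite psumr_eq0 => [|i _]; last exact: gram_diag_ge0.
move=> /allP X0; apply/matrixP=> i j; rewrite mxE.
have := X0 i (mem_index_enum i); rewrite /= mxE psumr_eq0 => [|k _].
  by move=> /allP/(_ j (mem_index_enum j)); rewrite !mxE mul_conjC_eq0 => /eqP.
by rewrite !mxE mul_conjC_ge0.
Qed.

Lemma gram_eq0 m n (X : 'M[C]_(m, n)) : X *m X^H = 0 -> X = 0.
Proof. by move=> X0; apply: gram_trace_eq0; rewrite X0 mxtrace0. Qed.

End Adjoint.

(** * Calculus of positive semi-definite operators *)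

Section PositiveSemidefinite.
Variable C : numClosedFieldType.

Lemma psdmx_adj n (A : 'M[C]_n) : psdmx A -> A^H = A.
Proof. by case=> /hermsymmxE. Qed.

Lemma psdmxE n (A : 'M[C]_n) :
  psdmx A <-> A^H = A /\ forall v : 'rV[C]_n, 0 <= (v *m A *m v^H) 0 0.
Proof.
split=> -[hA pA]; split; try exact/hermsymmxE.
- by move=> v; have := pA v; rewrite dotmxE.
- by move=> v; rewrite dotmxE.
Qed.

Lemma psdmx_gram n p (X : 'M[C]_(n, p)) : psdmx (X *m X^H).
Proof.
apply/psdmxE; split=> [|v]; first by rewrite adjmxM adjmxK.
by rewrite mulmxA -mulmxA -adjmxM gram_diag_ge0.
Qed.

(** The spectral theorem gives [X = U^H *m diag_mx s] with [s] the square roots of the eigenvalues.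
    Later positivity arguments reduce to Gram matrices through this factorization. *)
Lemma psdmx_factor n (A : 'M[C]_n) : psdmx A -> exists X : 'M[C]_n, A = X *m X^H.
Proof.
move=> psdA; have [hA _] := psdA; have [_ pA] := proj1 (psdmxE A) psdA.
have /hermitian_normalmx/orthomx_spectralP := hA.
set U := spectralmx A; set d := spectral_diag A.
have uU : U \is unitarymx by exact: spectral_unitarymx.
have UUH : U *m U^H = 1%:M by exact/unitarymxP.
rewrite invmx_unitary // -[map_mx _ _]/(U^H) => eA.
(* The quadratic form of [A] at the [i]-th row of [U] is the [i]-th eigenvalue. *)
have d_ge0 i : 0 <= d 0 i.
  have := pA (delta_mx 0 i *m U); rewrite eA adjmxM -!mulmxA (mulmxA U).
  rewrite UUH mul1mx (mulmxA U) UUH mul1mx mulmxA -rowE row_diag_mx.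
  rewrite -scalemxAl mxE /adjmx trmx_delta map_delta_mx mul_delta_mx.
  by rewrite mxE !eqxx mulr1.
pose s : 'rV[C]_n := map_mx sqrtC d.
exists (U^H *m diag_mx s).
have hs : (diag_mx s)^H = diag_mx s.
  rewrite /adjmx tr_diag_mx map_diag_mx; congr diag_mx; apply/rowP=> i.
  by rewrite !mxE; apply: geC0_conj; rewrite sqrtC_ge0.
rewrite adjmxM adjmxK hs mulmxA -(mulmxA U^H) mulmx_diag {1}eA.
congr (_ *m diag_mx _ *m _).
by apply/rowP=> i; rewrite !mxE -expr2 sqrtCK.
Qed.

Lemma psdmxD n (A B : 'M[C]_n) : psdmx A -> psdmx B -> psdmx (A + B).
Proof.
move=> /psdmxE[hA pA] /psdmxE[hB pB]; apply/psdmxE; split=> [|v].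
  by rewrite adjmxD hA hB.
by rewrite mulmxDr mulmxDl mxE addr_ge0.
Qed.

Lemma psdmxZ n a (A : 'M[C]_n) : 0 <= a -> psdmx A -> psdmx (a *: A).
Proof.
move=> a_ge0 /psdmxE[hA pA]; apply/psdmxE; split=> [|v].
  by rewrite adjmxZ hA geC0_conj.
by rewrite -scalemxAr -scalemxAl mxE mulr_ge0.
Qed.

Lemma psdmx0 n : psdmx (0 : 'M[C]_n).
Proof. by rewrite -(mul0mx n (0 : 'M[C]_n)^H); exact: psdmx_gram. Qed.

Lemma psdmx_conj m n (X : 'M[C]_(m, n)) A : psdmx A -> psdmx (X *m A *m X^H).
Proof.
move=> /psdmx_factor[Y ->]; rewrite mulmxA -mulmxA -adjmxM.
exact: psdmx_gram.
Qed.

Lemma psdmx_conj_eq0 m n (X : 'M[C]_(m, n)) A :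
  psdmx A -> X *m A *m X^H = 0 -> X *m A = 0.
Proof.
move=> /psdmx_factor[Y ->]; rewrite !mulmxA -mulmxA -adjmxM => /gram_eq0 ->.
by rewrite mul0mx.
Qed.

(** The traces of [X A X^H] and [X B X^H] are nonnegative and sum to 0, so both vanish: the kernel
    of a sum lies in the kernel of each summand. *)
Lemma psdmx_mulD_eq0 m n (X : 'M[C]_(m, n)) A B :
  psdmx A -> psdmx B -> X *m (A + B) = 0 -> X *m A = 0.
Proof.
move=> psdA psdB XAB; apply: psdmx_conj_eq0 => //.
have: X *m A *m X^H + X *m B *m X^H = 0.
  by rewrite -mulmxDl -mulmxDr XAB mul0mx.
have [[Y ->] [Z ->]] := (psdmx_factor psdA, psdmx_factor psdB).
rewrite !mulmxA -(mulmxA _ Y^H) -(mulmxA _ Z^H) -!adjmxM.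
move=> /(congr1 mxtrace)/eqP; rewrite mxtraceD mxtrace0.
rewrite paddr_eq0 ?gram_trace_ge0 // => /andP[/eqP/gram_trace_eq0-> _].
by rewrite mul0mx.
Qed.

(** For [A = X X^H] and [B = Y Y^H], cyclicity turns [tr (A B)] into the squared Hilbert-Schmidt
    norm of [Y^H X]. *)
Lemma psdmx_trM_ge0 n (A B : 'M[C]_n) : psdmx A -> psdmx B -> 0 <= \tr (A *m B).
Proof.
move=> /psdmx_factor[X ->] /psdmx_factor[Y ->].
rewrite mulmxA mxtrace_mulC !mulmxA -(mulmxA _ X^H).
by rewrite -{2}(adjmxK Y) -adjmxM gram_trace_ge0.
Qed.

Lemma psdmx_trM_eq0 n (A B : 'M[C]_n) :
  psdmx A -> psdmx B -> \tr (A *m B) = 0 -> A *m B = 0.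
Proof.
move=> /psdmx_factor[X ->] /psdmx_factor[Y ->] tr0.
suff XY0 : Y^H *m X = 0.
  by rewrite mulmxA -(mulmxA X) -{1}[Y]adjmxK -adjmxM XY0 adjmx0 mulmx0 mul0mx.
apply: gram_trace_eq0; rewrite -tr0 adjmxM adjmxK [in RHS]mulmxA.
by rewrite [in RHS]mxtrace_mulC !mulmxA.
Qed.

(** By Cauchy-Schwarz, [a |<v, s>|^2 <= a |s|^2 |v|^2 <= |v|^2]. *)
Lemma psdmx_sub_rank1 n a (s : 'rV[C]_n) :
  0 <= a -> a * (s *m s^H) 0 0 <= 1 -> psdmx (1%:M - a *: (s^H *m s)).
Proof.
move=> a_ge0 as_le1; apply/psdmxE; split=> [|v].
  by rewrite adjmxB adjmx1 adjmxZ geC0_conj // adjmxM adjmxK.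
rewrite mulmxBr mulmx1 mulmxBl -scalemxAr -scalemxAl.
rewrite mxE [X in _ + X]mxE [X in _ - X]mxE subr_ge0.
have CS : `|(v *m s^H) 0 0| ^+ 2 <= (v *m v^H) 0 0 * (s *m s^H) 0 0.
  by have [+ _] := CauchySchwarz (@dotmx C n) v s; rewrite /= !dotmxE.
have -> : (v *m (s^H *m s) *m v^H) 0 0 = `|(v *m s^H) 0 0| ^+ 2.
  rewrite mulmxA -mulmxA -{2}[s]adjmxK -adjmxM [LHS]mxE big_ord1 normCK.
  by rewrite /adjmx !mxE.
rewrite (le_trans (ler_wpM2l a_ge0 CS)) // mulrCA ler_piMr //.
exact: gram_diag_ge0.
Qed.

End PositiveSemidefinite.

(** * Orthogonal projectors, supports and kernels *)

Section OrthogonalProjections.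
Variable C : numClosedFieldType.

(** The rows of [1 - P] are orthogonal to those of [P], so [P^H = P P^H], which is self-adjoint. *)
Lemma proj_ortho_adj n p (U : 'M[C]_(p, n)) : (proj_ortho U)^H = proj_ortho U.
Proof.
set P := proj_ortho U.
have PPH : (1%:M - P) *m P^H = 0.
  apply/orthomx1P; rewrite (eqmx_ortho _ (proj_orthoE U)).
  by have := proj_ortho_compl_sub U 1%:M; rewrite mul1mx.
have eP : P^H = P *m P^H.
  by apply/eqP; rewrite -subr_eq0 -[X in X - _]mul1mx -mulmxBl PPH.
by rewrite -[RHS]adjmxK eP (adjmxM P P^H) adjmxK.
Qed.

(** The rows of a self-adjoint [A] are orthogonal to its kernel, and the dimensions agree. *)
Lemma supp_eqmx n (A : 'M[C]_n) : A^H = A -> (supp A :=: A)%MS.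
Proof.
move=> hA; apply/eqmx_sym/eqmxP; rewrite -mxrank_leqif_eq.
  rewrite /supp /orthocompl rank_ortho mxrank_ker subKn //.
  exact: rank_leq_row.
rewrite /supp /orthocompl orthomx_sym; apply/orthomx1P.
by rewrite -[map_mx _ _]/(A^H) hA mulmx_ker.
Qed.

(** The orthogonal complement of the sum of the kernels lies in both supports. *)
Lemma supp_cap0_addsmx_ker n (A B : 'M[C]_n) :
  (supp A :&: supp B = 0)%MS -> (1%:M <= kermx A + kermx B)%MS.
Proof.
move=> AB0; rewrite -submx_ortho (submx_trans _ (sub0mx n _)) // -AB0.
by rewrite sub_capmx /supp /orthocompl !submx_ortho addsmxSl addsmxSr.
Qed.

(* Locked, since [proj_ortho] unfolds to a product, on which rewriting with
   [mulmxA] or [adjmxM] would act. *)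
Fact kerproj_key : unit. Proof. by []. Qed.

Definition kerproj n (A : 'M[C]_n) : 'M[C]_n :=
  locked_with kerproj_key (proj_ortho (kermx A)).

Lemma kerprojE n (A : 'M[C]_n) : kerproj A = proj_ortho (kermx A).
Proof. exact: locked_withE. Qed.

Lemma kerproj_adj n (A : 'M[C]_n) : (kerproj A)^H = kerproj A.
Proof. by rewrite kerprojE proj_ortho_adj. Qed.

Lemma kerproj_idem n (A : 'M[C]_n) : kerproj A *m kerproj A = kerproj A.
Proof. by rewrite kerprojE proj_ortho_proj. Qed.

Lemma mul_kerproj n (A : 'M[C]_n) : kerproj A *m A = 0.
Proof. by apply/sub_kermxP; rewrite kerprojE proj_orthoE. Qed.

Lemma kerproj_mul n (A : 'M[C]_n) : A^H = A -> A *m kerproj A = 0.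
Proof. by move=> hA; rewrite -kerproj_adj -{1}hA -adjmxM mul_kerproj adjmx0. Qed.

Lemma kerproj_id m n (A : 'M[C]_n) (B : 'M[C]_(m, n)) :
  B *m A = 0 -> B *m kerproj A = B.
Proof. by move=> /sub_kermxP BA; rewrite kerprojE proj_ortho_id. Qed.

Lemma kerproj_compl n (A : 'M[C]_n) :
  A^H = A -> (1%:M - kerproj A <= A)%MS.
Proof.
move=> hA; rewrite -(supp_eqmx hA) kerprojE.
by have := proj_ortho_compl_sub (kermx A) 1%:M; rewrite mul1mx.
Qed.

Lemma psdmx_kerproj n (A : 'M[C]_n) : psdmx (kerproj A).
Proof. by rewrite -kerproj_idem -{2}kerproj_adj; exact: psdmx_gram. Qed.

Lemma psdmx_kerproj_compl n (A : 'M[C]_n) : psdmx (1%:M - kerproj A).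
Proof.
suff -> : 1%:M - kerproj A = (1%:M - kerproj A) *m (1%:M - kerproj A)^H.
  exact: psdmx_gram.
rewrite adjmxB adjmx1 kerproj_adj mulmxBr mulmx1 mulmxBl mul1mx kerproj_idem.
by rewrite subrr subr0.
Qed.

End OrthogonalProjections.

(** * The support of the pair and the projector [Lambda2] *)

Section Discrimination.
Variables (C : numClosedFieldType) (n : nat) (g1 g2 : 'M[C]_n).
Hypotheses (psd_g1 : psdmx g1) (psd_g2 : psdmx g2).

Let hg1 : g1^H = g1 := psdmx_adj psd_g1.
Let hg2 : g2^H = g2 := psdmx_adj psd_g2.

Local Notation Q := (kerproj g1).
Local Notation Z := (Q *m g2 *m Q).
Local Notation P := (proj_ortho (supp_pair g1 g2)).

Let psdZ : psdmx Z.
Proof. by rewrite -{2}kerproj_adj; exact: psdmx_conj. Qed.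

Let hg12 : (g1 + g2)^H = g1 + g2.
Proof. by rewrite adjmxD hg1 hg2. Qed.

Lemma mul_add_psdmx_eq0 m (X : 'M[C]_(m, n)) :
  X *m (g1 + g2) = 0 -> X *m g1 = 0 /\ X *m g2 = 0.
Proof.
move=> X0; split; first exact: psdmx_mulD_eq0 X0.
by apply: (psdmx_mulD_eq0 psd_g2 psd_g1); rewrite addrC.
Qed.

Lemma sub_supp_pair m (X : 'M[C]_(m, n)) :
  (forall v : 'M[C]_n, v *m g1 = 0 -> v *m g2 = 0 -> v *m X^H = 0) ->
  (X <= supp_pair g1 g2)%MS.
Proof.
move=> kerX; rewrite /supp_pair /supp /orthocompl orthomx_sym.
apply/orthomx1P; have [] := mul_add_psdmx_eq0 (mulmx_ker (g1 + g2)).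
exact: kerX.
Qed.

Lemma mul_proj_supp_pair_eq0 m (X : 'M[C]_(m, n)) :
  X *m (g1 + g2) = 0 -> X *m P = 0.
Proof.
move=> X0; have /submxP[M eP] : (P <= (g1 + g2)%R)%MS.
  by rewrite proj_orthoE /supp_pair (supp_eqmx hg12).
by rewrite -proj_ortho_adj eP adjmxM hg12 mulmxA X0 mul0mx.
Qed.

Lemma proj_supp_pair_g2 : P *m g2 = g2.
Proof.
have g2P : g2 *m P = g2.
  by rewrite proj_ortho_id //; apply: sub_supp_pair => v _; rewrite hg2.
by have := congr1 (@adjmx _ _ _) g2P; rewrite adjmxM proj_ortho_adj hg2.
Qed.

(** Since [supp g1] lies in the support of the pair, [(1 - Q) P = 1 - Q]; compare with the adjoint
    identity. *)
Lemma kerproj_proj_comm : Q *m P = P *m Q.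
Proof.
have e : (1%:M - Q) *m P = 1%:M - Q.
  rewrite proj_ortho_id // (submx_trans (kerproj_compl hg1)) //.
  by apply: sub_supp_pair => v; rewrite hg1.
have := congr1 (@adjmx _ _ _) e.
rewrite adjmxM adjmxB adjmx1 proj_ortho_adj kerproj_adj -[RHS]e.
by rewrite mulmxBr mulmxBl mulmx1 mul1mx => /addrI/oppr_inj.
Qed.

(** The rows of [Q P = P Q] lie in both subspaces, so [Q P L = Q P]; the adjoint of [L P Q = L]
    gives [Q P L = L]. *)
Lemma Lambda2E : Lambda2 g1 g2 = Q *m P.
Proof.
set L := Lambda2 g1 g2.
have /andP[LK LS] : (L <= kermx g1)%MS && (L <= supp_pair g1 g2)%MS.
  by rewrite -sub_capmx /L /Lambda2 proj_orthoE.
have LPQ : L *m P *m Q = L by rewrite kerprojE !proj_ortho_id.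
have /proj_ortho_id QPL : (Q *m P <= kermx g1 :&: supp_pair g1 g2)%MS.
  by rewrite sub_capmx {1}kerproj_proj_comm kerprojE !proj_ortho_sub.
rewrite -[RHS]QPL -[proj_ortho (_ :&: _)%MS]/L -[LHS]proj_ortho_adj.
rewrite -[proj_ortho _]/L -{1}LPQ.
by rewrite (adjmxM (L *m P)) (adjmxM L) kerproj_adj !proj_ortho_adj mulmxA.
Qed.

Lemma tr_Lambda2 : \tr (Lambda2 g1 g2 *m g2) = \tr (Q *m g2).
Proof. by rewrite Lambda2E -mulmxA proj_supp_pair_g2. Qed.

(** [A Z A^H] is the Gram-type form [(A Q) g2 (A Q)^H]. *)
Lemma psdmx_mul_kerproj_eq0 A : psdmx A -> A *m Z = 0 -> A *m Q *m g2 = 0.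
Proof.
move=> psdA AZ0; apply: psdmx_conj_eq0 => //.
rewrite adjmxM kerproj_adj mulmxA -(mulmxA A) -(mulmxA A) AZ0.
by rewrite mul0mx.
Qed.

(** * Duality bounds, sufficiency of the condition, and proper measurements *)

Section Measurement.
Variables (E1 E2 Einc : 'M[C]_n).
Hypothesis usdE : usd_measurement g1 g2 E1 E2 Einc.

Let psdE1 : psdmx E1. Proof. by case: usdE => -[]. Qed.
Let psdE2 : psdmx E2. Proof. by case: usdE => -[]. Qed.
Let psdEinc : psdmx Einc. Proof. by case: usdE => -[]. Qed.

Lemma usd_E1g2 : E1 *m g2 = 0.
Proof. by case: usdE => _ _ _; exact: psdmx_trM_eq0. Qed.

Lemma usd_g2E1 : g2 *m E1 = 0.
Proof. by rewrite -hg2 -(psdmx_adj psdE1) -adjmxM usd_E1g2 adjmx0. Qed.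

Lemma usd_E2g1 : E2 *m g1 = 0.
Proof. by case: usdE => _ _ + _; exact: psdmx_trM_eq0. Qed.

Lemma usd_g1E2 : g1 *m E2 = 0.
Proof. by rewrite -hg1 -(psdmx_adj psdE2) -adjmxM usd_E2g1 adjmx0. Qed.

Lemma usd_E2Q : E2 *m Q = E2.
Proof. exact/kerproj_id/usd_E2g1. Qed.

Lemma usd_QE2 : Q *m E2 = E2.
Proof.
have := congr1 (@adjmx _ _ _) usd_E2Q.
by rewrite adjmxM kerproj_adj (psdmx_adj psdE2).
Qed.

Lemma usd_tr_E2 : \tr (E2 *m g2) = \tr (E2 *m Z).
Proof. by rewrite !mulmxA usd_E2Q [RHS]mxtrace_mulC !mulmxA usd_QE2. Qed.

(** Completeness of the measurement is paired with the dual variable [Z], whose trace is the value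
    of [(0, Q, 1 - Q)]. *)
Lemma usd_tr_sum :
  \tr (E1 *m Z) + \tr (E2 *m g2) + \tr (Einc *m Z) = \tr (Q *m g2).
Proof.
case: usdE => _ sumE _ _; rewrite usd_tr_E2 -!mxtraceD -!mulmxDl sumE mul1mx.
by rewrite mxtrace_mulC mulmxA kerproj_idem.
Qed.

Lemma usd_E2_le : \tr (E2 *m g2) <= \tr (Q *m g2).
Proof.
rewrite -usd_tr_sum addrAC lerDr.
by rewrite addr_ge0 // psdmx_trM_ge0.
Qed.

Lemma usd_E1_le : psdmx (g1 *m (g2 - g1) *m g1) ->
  \tr (E1 *m g1) <= \tr (E1 *m Z).
Proof.
move=> psd_cond; set K := 1%:M - Q.
have hK : K^H = K by rewrite adjmxB adjmx1 kerproj_adj.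
have /submxP[M eK] := kerproj_compl hg1.
(* Writing [K = M g1 = g1 M^H] makes this a conjugate by [M] of the operator in the hypothesis. *)
have psdK : psdmx (K *m (g2 - g1) *m K).
  rewrite -{2}hK [K]eK adjmxM hg1.
  by have := psdmx_conj M psd_cond; rewrite !mulmxA.
have Kg1 : K *m g1 *m K = g1.
  by rewrite /K mulmxBl mul1mx mul_kerproj subr0 mulmxBr mulmx1 kerproj_mul ?subr0.
(* From [E1 g2 = 0], [E1 K g2 K = - E1 Q g2 + E1 Z], and the first term is traceless because
   [g2 E1 = 0]. *)
have E1K : \tr (E1 *m (K *m g2 *m K)) = \tr (E1 *m Z).
  have E1Kg2 : E1 *m K *m g2 = - (E1 *m Q *m g2).
    by rewrite mulmxBr mulmx1 mulmxBl usd_E1g2 sub0r.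
  rewrite !mulmxA E1Kg2 mulmxBr mulmx1.
  rewrite mulNmx opprK mxtraceD (_ : \tr (- _) = 0) ?add0r //.
  by rewrite linearN /= mxtrace_mulC mulmxA usd_g2E1 mul0mx mxtrace0 oppr0.
rewrite -subr_ge0 -E1K -{1}Kg1 -linearB /= -mulmxBr -!mulmxBl -mulmxBr.
exact: psdmx_trM_ge0.
Qed.

Lemma usd_tr_E1_eq0 : psdmx (g1 *m (g2 - g1) *m g1) ->
  \tr (Q *m g2) <= psucc g1 g2 E1 E2 -> \tr (E1 *m g1) = 0.
Proof.
move=> psd_cond opt; have E1_le := usd_E1_le psd_cond.
have sumE : E1 + E2 + Einc = 1%:M by case: usdE.
(* Complementary slackness: in [usd_tr_sum] the first two terms already reach the total. *)
have EincZ : \tr (Einc *m Z) = 0.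
  apply/le_anti; rewrite psdmx_trM_ge0 // andbT.
  rewrite -(lerD2l (\tr (E1 *m Z) + \tr (E2 *m g2))) usd_tr_sum addr0.
  by rewrite (le_trans opt) // lerD2r.
have EincQ : Einc *m Q *m g2 = 0.
  exact/psdmx_mul_kerproj_eq0/psdmx_trM_eq0.
have E1Q : E1 *m Q *m g2 = Q *m g2 - E2 *m g2.
  have := congr1 (fun X => X *m Q *m g2) sumE.
  by rewrite !mulmxDl EincQ addr0 mul1mx usd_E2Q => <-; rewrite addrK.
(* By [E1Q], the columns of [Y] lie in the kernel of [g1], so [Q] fixes [Y]; then
   [g2 Q E1 Q g2 = g2 Y = 0] because [g2 E1 = 0]. *)
pose Y := E1 *m Q *m g2.
have g1Y : Y^H *m g1 = 0.
  rewrite -{1}hg1 -adjmxM [Y]E1Q mulmxBr !mulmxA kerproj_mul // usd_g1E2.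
  by rewrite !mul0mx subr0 adjmx0.
have QY : Q *m Y = Y.
  have := congr1 (@adjmx _ _ _) (kerproj_id g1Y).
  by rewrite adjmxM kerproj_adj adjmxK.
have E1g2Q : g2 *m Q *m E1 = 0.
  apply: psdmx_conj_eq0 => //; rewrite adjmxM hg2 kerproj_adj.
  by rewrite -!mulmxA (mulmxA E1) -[E1 *m Q *m g2]/Y QY !mulmxA usd_g2E1 !mul0mx.
apply/le_anti; rewrite psdmx_trM_ge0 // (le_trans E1_le) //.
by rewrite !mulmxA -mulmxA mxtrace_mulC mulmxA E1g2Q mul0mx mxtrace0.
Qed.

Lemma usd_proper : \tr (E1 *m g1) = 0 -> \tr (E2 *m g2) = \tr (Q *m g2) ->
  proper_usd g1 g2 E1 E2 -> E1 = 0 /\ E2 = Lambda2 g1 g2.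
Proof.
move=> /psdmx_trM_eq0 E1g1 trE2 proper.
have sumE : E1 + E2 + Einc = 1%:M by case: usdE.
have [E1P E2P] : E1 *m P = E1 /\ E2 *m P = E2.
  have psdE : psdmx (E1 + E2) by exact: psdmxD.
  have EP : (E1 + E2) *m P = E1 + E2.
    by rewrite proj_ortho_id // -(supp_eqmx (psdmx_adj psdE)).
  (* Properness concerns only the sum; positivity passes the vanishing on to each of [E1] and
     [E2]. *)
  have PE : (1%:M - P) *m (E1 + E2) = 0.
    have := congr1 (@adjmx _ _ _) EP.
    rewrite adjmxM proj_ortho_adj (psdmx_adj psdE) mulmxBl mul1mx => ->.
    by rewrite subrr.
  have fixP A : psdmx A -> (1%:M - P) *m A = 0 -> A *m P = A.
    move=> psdA; rewrite mulmxBl mul1mx => /subr0_eq eA.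
    have := congr1 (@adjmx _ _ _) eA.
    by rewrite (adjmxM P) proj_ortho_adj (psdmx_adj psdA).
  split; apply: fixP => //; first exact: psdmx_mulD_eq0 PE.
  by apply: (psdmx_mulD_eq0 psdE2 psdE1); rewrite (addrC E2).
split.
  rewrite -E1P; apply: mul_proj_supp_pair_eq0.
  by rewrite mulmxDr E1g1 // usd_E1g2 addr0.
rewrite Lambda2E -E2P; apply/eqP; rewrite -subr_eq0 -mulmxBl; apply/eqP.
apply: mul_proj_supp_pair_eq0.
rewrite mulmxBl !mulmxDr usd_E2g1 mul_kerproj !add0r.
have psdF : psdmx (E1 + Einc) by exact: psdmxD.
have eF : E1 + Einc = 1%:M - E2 by rewrite -sumE addrAC addrK.
(* Attaining the bound leaves no weight of [Z] on [E1 + Einc = 1 - E2], hence [Q g2 = E2 g2]. *)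
have /(psdmx_trM_eq0 psdF psdZ)/(psdmx_mul_kerproj_eq0 psdF) :
    \tr ((E1 + Einc) *m Z) = 0.
  apply: (addIr (\tr (E2 *m g2))).
  by rewrite mulmxDl mxtraceD add0r [RHS]trE2 -usd_tr_sum addrAC.
rewrite eF -mulmxA mulmxBl mul1mx mulmxA usd_E2Q => /subr0_eq <-.
by rewrite subrr.
Qed.

End Measurement.

(** * Test measurements and necessity of the condition *)

Lemma usd_kerproj : usd_measurement g1 g2 0 Q (1%:M - Q).
Proof.
split; first by split; [exact: psdmx0 | exact: psdmx_kerproj
                       | exact: psdmx_kerproj_compl].
- by rewrite add0r addrC subrK.
- by rewrite mul_kerproj mxtrace0.
- by rewrite mul0mx mxtrace0.
Qed.

(** Large [t] means a small perturbation of [(0, Q, 1 - Q)]. The weight [1 / t^2] removed along [y]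
    and the weight [1 / (|x|^2 + t^2)] given to [w] agree to leading order; the extra [|x|^2] keeps
    the inconclusive operator positive. *)
Lemma usd_perturbed (t : C) (w y : 'rV[C]_n) (x := w - y) :
  0 < t -> w *m g2 = 0 -> y *m g1 = 0 -> x *m Q = 0 ->
  (y *m y^H) 0 0 <= t ^+ 2 ->
  let E1 := ((x *m x^H) 0 0 + t ^+ 2)^-1 *: (w^H *m w) in
  let E2 := Q - (t ^+ 2)^-1 *: (y^H *m y) in
  usd_measurement g1 g2 E1 E2 (1%:M - E1 - E2).
Proof.
move=> t_gt0 wg2 yg1 xQ y_le E1 E2.
have t2_gt0 : 0 < t ^+ 2 by rewrite exprn_gt0.
have N_gt0 : 0 < (x *m x^H) 0 0 + t ^+ 2 by rewrite ltr_wpDl ?gram_diag_ge0.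
have yQ : y *m Q = y by exact: kerproj_id.
have QyH : Q *m y^H = y^H by rewrite -kerproj_adj -adjmxM yQ.
split; last 3 first.
- by rewrite -[1%:M - E1 - E2]addrA -opprD subrKC.
- by rewrite mulmxBl mul_kerproj -scalemxAl -mulmxA yg1 mulmx0 scaler0 subrr mxtrace0.
- by rewrite -scalemxAl -mulmxA wg2 mulmx0 scaler0 mxtrace0.
split.
- apply: psdmxZ; first by rewrite invr_ge0 ltW.
  by rewrite -{2}[w]adjmxK; exact: psdmx_gram.
(* As [Q] fixes [y], it can be pulled out on both sides; [|y|^2 <= t^2] makes the middle factor
   positive. *)
- have -> : E2 = Q *m (1%:M - (t ^+ 2)^-1 *: (y^H *m y)) *m Q^H.
    rewrite kerproj_adj mulmxBr mulmx1 mulmxBl kerproj_idem -scalemxAr.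
    by rewrite -scalemxAl mulmxA QyH -mulmxA yQ.
  apply/psdmx_conj/psdmx_sub_rank1; first by rewrite invr_ge0 ltW.
  by rewrite mulrC ler_pdivrMr // mul1r.
(* Here V^* V = 1 - Q + y^* y / t^2 and s V = w, so the
   inconclusive operator is V^* (1 - s^* s / |s|^2) V. *)
pose V := col_mx (1%:M - Q) (t^-1 *: y).
pose s := row_mx x (t%:M : 'M[C]_1).
have tC : t^* = t by exact/geC0_conj/ltW.
have tVC : (t^-1)^* = t^-1 by apply/geC0_conj; rewrite invr_ge0 ltW.
have VH : V^H = row_mx (1%:M - Q) (t^-1 *: y^H).
  rewrite /V /adjmx tr_col_mx map_row_mx -!/(adjmx _) adjmxB adjmx1.
  by rewrite kerproj_adj adjmxZ tVC.
have sV : s *m V = w.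
  rewrite mul_row_col mulmxBr mulmx1 xQ subr0 mul_scalar_mx scalerA.
  by rewrite divff ?gt_eqF // scale1r /x subrK.
have ss : (s *m s^H) 0 0 = (x *m x^H) 0 0 + t ^+ 2.
  rewrite /s /adjmx tr_row_mx map_col_mx mul_row_col mxE; congr (_ + _).
  have -> : map_mx Num.conj (t%:M)^T = t%:M :> 'M[C]_1.
    by apply/matrixP=> i j; rewrite !ord1 !mxE eqxx mulr1n.
  by rewrite -scalar_mxM mxE eqxx mulr1n.
have -> : 1%:M - E1 - E2
  = V^H *m (1%:M - (((x *m x^H) 0 0 + t ^+ 2)^-1) *: (s^H *m s)) *m V^H^H.
  rewrite adjmxK mulmxBr mulmx1 mulmxBl -scalemxAr -scalemxAl (mulmxA V^H).
  rewrite -(mulmxA _ s) sV -adjmxM sV VH mul_row_col mulmxBr mulmx1 mulmxBl mul1mx.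
  rewrite kerproj_idem subrr subr0 -scalemxAl -scalemxAr scalerA -invfM -expr2.
  by rewrite /E2 opprB (addrC _ (- Q)) addrA (addrAC 1%:M) addrAC.
apply/psdmx_conj/psdmx_sub_rank1; first by rewrite invr_ge0 ltW.
by rewrite ss mulVf // gt_eqF.
Qed.

End Discrimination.

(** An explicit [t] replaces the limit of large [t]. If [b < a], the inequality rearranges to
    [t^2 <= D], but [t = 1 + M + D] gives [D < t <= t^2], while also [M <= t^2]. *)
Lemma le_of_perturbed_le (C : numClosedFieldType) (a b N M : C) :
  0 <= a -> 0 <= b -> 0 <= N -> 0 <= M ->
  (forall t, 0 < t -> M <= t ^+ 2 -> a / (N + t ^+ 2) <= b / t ^+ 2) -> a <= b.
Proof.
move=> a0 b0 N0 M0 le_ab.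
have [//|lt_ba] := real_leP (ger0_real a0) (ger0_real b0).
pose D := b * N / (a - b); pose t := 1 + M + D.
have d_gt0 : 0 < a - b by rewrite subr_gt0.
have D0 : 0 <= D by rewrite divr_ge0 ?mulr_ge0 // ltW.
have t1 : 1 <= t by rewrite /t -addrA lerDl addr_ge0.
have t_gt0 : 0 < t := lt_le_trans ltr01 t1.
have t_le : t <= t ^+ 2 by rewrite expr2 ler_peMl // ltW.
have t2_gt0 : 0 < t ^+ 2 by rewrite exprn_gt0.
have := le_ab t t_gt0 (le_trans _ t_le).
rewrite {1}/t addrAC lerDr addr_ge0 // => /(_ isT).
rewrite ler_pdivrMr ?ltr_wpDl // mulrAC ler_pdivlMr //.
rewrite mulrDr -lerBlDr -mulrBl -ler_pdivlMl // mulrC.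
move=> /(le_trans t_le); rewrite -/D => t_le_D.
have : D < t by rewrite /t ltrDr ltr_wpDr.
by move=> /lt_le_trans/(_ t_le_D); rewrite ltxx.
Qed.

Lemma optimal_usd_cond (C : numClosedFieldType) n (g1 g2 E1 E2 Einc : 'M[C]_n) :
  psdmx g1 -> psdmx g2 -> (supp g1 :&: supp g2 = 0)%MS ->
  optimal_usd g1 g2 E1 E2 Einc -> \tr (E1 *m g1) = 0 ->
  psdmx (g1 *m (g2 - g1) *m g1).
Proof.
move=> psd_g1 psd_g2 supp_disj [usdE optE] trE1.
have [hg1 hg2] := (psdmx_adj psd_g1, psdmx_adj psd_g2).
apply/psdmxE; split=> [|v].
  by rewrite !adjmxM adjmxB hg1 hg2 mulmxA.
pose x := v *m g1.
have -> : v *m (g1 *m (g2 - g1) *m g1) *m v^H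
          = x *m g2 *m x^H - x *m g1 *m x^H.
  by rewrite -mulmxBl -mulmxBr adjmxM hg1 !mulmxA.
rewrite mxE [X in _ + X]mxE subr_ge0.
have : (x <= kermx g1 + kermx g2)%MS.
  exact: submx_trans (submx1 _) (supp_cap0_addsmx_ker supp_disj).
move=> /sub_addsmxP[[u1 u2] /= eu].
pose w := u2 *m kermx g2; pose y := - (u1 *m kermx g1).
have ex : x = w - y by rewrite eu addrC opprK.
have wg2 : w *m g2 = 0 by rewrite -mulmxA mulmx_ker mulmx0.
have yg1 : y *m g1 = 0 by rewrite mulNmx -mulmxA mulmx_ker mulmx0 oppr0.
clearbody w y.
have xQ : x *m kerproj g1 = 0 by rewrite -mulmxA kerproj_mul ?mulmx0.
have form_ge0 (A : 'M[C]_n) (z : 'rV[C]_n) :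
  psdmx A -> 0 <= (z *m A *m z^H) 0 0 by case/psdmxE.
have tr_form (A : 'M[C]_n) (z : 'rV[C]_n) :
  \tr (z^H *m z *m A) = (z *m A *m z^H) 0 0.
  by rewrite -mulmxA mxtrace_mulC trace_mx11.
(* [x] differs from [w] by a vector in the kernel of [g1], and from [- y] by one in the kernel of
   [g2]. *)
have wg1w : w *m g1 *m w^H = x *m g1 *m x^H.
  have g1y : g1 *m y^H = 0 by rewrite -{1}hg1 -adjmxM yg1 adjmx0.
  by rewrite ex mulmxBl yg1 subr0 adjmxB mulmxBr -(mulmxA _ _ y^H) g1y mulmx0 subr0.
have yg2y : y *m g2 *m y^H = x *m g2 *m x^H.
  have g2w : g2 *m w^H = 0 by rewrite -{1}hg2 -adjmxM wg2 adjmx0.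
  rewrite ex mulmxBl wg2 sub0r adjmxB mulmxBr !mulNmx -(mulmxA _ _ w^H) g2w.
  by rewrite mulmx0 oppr0 sub0r opprK.
apply: (le_of_perturbed_le (N := (x *m x^H) 0 0) (M := (y *m y^H) 0 0));
  rewrite ?form_ge0 ?gram_diag_ge0 // => t t_gt0 y_le.
rewrite ex in xQ; have := optE _ _ _ (usd_perturbed t_gt0 wg2 yg1 xQ y_le).
rewrite -ex /psucc trE1 add0r => le_opt.
(* With [tr (E1 g1) = 0] the optimal value is at most [tr (Q g2)], so the gain of the perturbation
   cannot exceed its loss. *)
have := le_trans le_opt (usd_E2_le psd_g1 psd_g2 usdE).
rewrite mulmxBl linearB /= -!scalemxAl !linearZ /= !tr_form wg1w yg2y.
by rewrite addrCA gerDl subr_le0 mulrC (mulrC (_ ^-1)).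
Qed.

Local Open Scope complex_scope.

Theorem proposition12 (R : realType) (n : nat)
    (g1 g2 E1 E2 Einc : 'M[R[i]]_n)
    (psd_g1 : psdmx g1) (psd_g2 : psdmx g2)
    (supp_disj : (supp g1 :&: supp g2 = 0)%MS)
    (optE : optimal_usd g1 g2 E1 E2 Einc) :
  (\tr (E1 *m g1) = 0 <-> psdmx (g1 *m (g2 - g1) *m g1)) /\
  (\tr (E1 *m g1) = 0 ->
     psucc g1 g2 E1 E2 = \tr (Lambda2 g1 g2 *m g2) /\
     (proper_usd g1 g2 E1 E2 ->
        (E1, E2, Einc) = (0, Lambda2 g1 g2, 1%:M - Lambda2 g1 g2))).
Proof.
have [usdE maxE] := optE.
have le_psucc : \tr (kerproj g1 *m g2) <= psucc g1 g2 E1 E2.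
  have := maxE _ _ _ (usd_kerproj g1 g2).
  by rewrite /psucc mul0mx mxtrace0 add0r.
split; first split.
- exact: optimal_usd_cond optE.
- by move=> cond; apply: usd_tr_E1_eq0 usdE cond le_psucc.
(* Comparison with [(0, Q, 1 - Q)] bounds [tr (E2 g2)] below, duality bounds it above. *)
move=> trE1; have trE2 : \tr (E2 *m g2) = \tr (kerproj g1 *m g2).
  apply/le_anti; rewrite (usd_E2_le psd_g1 psd_g2 usdE).
  by move: le_psucc; rewrite /psucc trE1 add0r.
split; first by rewrite /psucc trE1 add0r trE2 tr_Lambda2.
move=> proper.
have [E1_0 E2_L] := usd_proper psd_g1 psd_g2 usdE trE1 trE2 proper.
case: usdE => _ <- _ _; rewrite E1_0 E2_L.
by rewrite add0r addrAC subrr add0r.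
Qed.
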